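(* In constructive mathematics, the statement ''for any two ordered sets $X$ and $Y$, the lexicographic order on the cartesian product $X\times Y$ is cotransitive'' implies the law of excluded middle.
   Context: The setting is constructive mathematics: no use of the law of excluded middle. An ordered set is a set $X$ with a binary relation $<$ such that for all $x,y,z\in X$: (1) $x<y$ implies $\neg(y<x)$; (2) $x<y$ implies $x<z$ or $z<y$ (cotransitivity); (3) $\neg(x<y)$ and $\neg(y<x)$ imply $x=y$. The cartesian product $X\times Y$ has equality $(x,y)=(x',y')$ iff $x=x'$ and $y=y'$. The lexicographic order on it is $(x,y)<(x',y')$ iff $x<x'$, or ($x=x'$ and $y<y'$). A relation $<$ is cotransitive if $a<b$ implies $a<c$ or $c<b$ for all $a,b,c$. *)

(* Defs.v *)
(* The ambient logic is that of Rocq without axioms: only the axiom-free files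
   below are loaded, so [excluded_middle] is a proposition that is not provable
   in this context. *)
From Stdlib Require Export RelationClasses Morphisms Relation_Definitions.
From Stdlib Require Export ClassicalFacts.

(* Sets are understood in Bishop's sense: a type together with an equality that
   is part of the data.  Relations on a set respect that equality. *)
Record BSet : Type := {
  carrier :> Type;
  eqs : relation carrier;
  eqs_equiv : Equivalence eqs
}.

Arguments eqs {_} _ _.
#[export] Existing Instance eqs_equiv.

Definition cotransitive {A : Type} (R : relation A) : Prop :=
  forall a b c : A, R a b -> R a c \/ R c b.

Record OrderedSet : Type := {
  oset :> BSet;
  lt : relation oset;
  lt_proper : Proper (eqs ==> eqs ==> iff) lt;
  lt_asym : forall x y : oset, lt x y -> ~ lt y x;
  lt_cotrans : cotransitive lt;
  lt_tight : forall x y : oset, ~ lt x y -> ~ lt y x -> eqs x y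
}.

Arguments lt {_} _ _.
#[export] Existing Instance lt_proper.

Definition prod_eqs (X Y : BSet) : relation (X * Y) :=
  fun p q => eqs (fst p) (fst q) /\ eqs (snd p) (snd q).

Lemma prod_eqs_equiv (X Y : BSet) : Equivalence (prod_eqs X Y).
Proof.
  split.
  - intros p; split; reflexivity.
  - intros p q [H K]; split; symmetry; assumption.
  - intros p q r [H K] [H' K']; split; etransitivity; eassumption.
Qed.

Definition prodB (X Y : BSet) : BSet :=
  {| carrier := X * Y; eqs := prod_eqs X Y; eqs_equiv := prod_eqs_equiv X Y |}.

Definition lex (X Y : OrderedSet) : relation (prodB X Y) :=
  fun p q => lt (fst p) (fst q) \/ (eqs (fst p) (fst q) /\ lt (snd p) (snd q)).

Lemma lex_proper (X Y : OrderedSet) : Proper (eqs ==> eqs ==> iff) (lex X Y).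
Proof.
  intros p p' [Hp Kp] q q' [Hq Kq]; unfold lex.
  rewrite Hp, Hq, Kp, Kq; reflexivity.
Qed.

(* Main.v *)
(** With [Y] the two-element chain, cotransitivity of the lexicographic order
    applied to [(x, 0) < (x, 1)] and [(z, y)] yields trichotomy of [x] and [z].
    For a proposition [P], order [{0, 1}] by letting [0 < 1] hold iff [P] does;
    tightness then makes [0] equal to [1] iff [~ P], so trichotomy decides [P]. *)
Require Import Defs.

(** The disjunction makes an equality of [false] and [true] yield [~ P] outright. *)
Definition two_eq (P : Prop) (a b : bool) : Prop := a = b \/ ~ P.

Lemma two_eq_equiv (P : Prop) : Equivalence (two_eq P).
Proof.
  split; unfold two_eq.
  - intros a; now left.
  - intros a b [->|H]; auto.
  - intros a b c [->|H] [->|K]; auto.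
Qed.

Definition two_set (P : Prop) : BSet :=
  {| carrier := bool; eqs := two_eq P; eqs_equiv := two_eq_equiv P |}.

Definition two_lt (P : Prop) (a b : bool) : Prop := a = false /\ b = true /\ P.

Lemma two_lt_proper (P : Prop) :
  Proper (two_eq P ==> two_eq P ==> iff) (two_lt P).
Proof.
  (* If [~ P], the relation is empty and both sides are false. *)
  intros a a' [->|H] b b' [->|K]; unfold two_lt; tauto.
Qed.

Lemma two_lt_asym (P : Prop) (a b : bool) : two_lt P a b -> ~ two_lt P b a.
Proof.
  intros [-> _] [_ [H _]]; discriminate H.
Qed.

Lemma two_lt_cotrans (P : Prop) : cotransitive (two_lt P).
Proof.
  intros a b [|] [Ha [Hb p]]; unfold two_lt; auto.
Qed.

Lemma two_lt_tight (P : Prop) (a b : bool) :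
  ~ two_lt P a b -> ~ two_lt P b a -> two_eq P a b.
Proof.
  unfold two_lt, two_eq; destruct a, b; tauto.
Qed.

Definition two (P : Prop) : OrderedSet :=
  {| oset := two_set P; lt := two_lt P; lt_proper := two_lt_proper P;
     lt_asym := two_lt_asym P; lt_cotrans := two_lt_cotrans P;
     lt_tight := two_lt_tight P |}.

Lemma lex_cotransitive_trichotomy (X : OrderedSet) :
  cotransitive (lex X (two True)) ->
  forall x z : X, lt x z \/ eqs x z \/ lt z x.
Proof.
  intros H x z.
  assert (Hlt : lex X (two True) (x, false) (x, true)).
  { right; split; [reflexivity | now repeat split]. }
  (* Any second coordinate for [z] would do: each of the four cases already compares [x] with
     [z]. *)
  destruct (H _ _ (z, false) Hlt) as [[K|[K _]]|[K|[K _]]]; simpl in K; auto.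
  right; left; now symmetry.
Qed.

Theorem theorem17 :
  (forall X Y : OrderedSet, cotransitive (lex X Y)) -> excluded_middle.
Proof.
  intros H P.
  (* [false] below [true] carries a proof of [P], equality leaves only [~ P], and [true] below
     [false] is absurd. *)
  destruct (lex_cotransitive_trichotomy (two P) (H _ _) false true)
    as [[_ [_ p]]|[[E|n]|[E _]]]; auto; discriminate E.
Qed.
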